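(* Let $I\subseteq\mathbb{R}$ be an open interval, let $K$ be $\mathbb{R}$ or $\mathbb{C}$, and let $B,C,R:I\to K$ be functions. Let $f:I\to K$ be a twice differentiable function with $f(x)\neq 0$ for all $x\in I$ which is a complementary solution, i.e. $$f''(x)+B(x)f'(x)+C(x)f(x)=0\quad\text{for all }x\in I.$$ Assume that the indefinite integrals $\int B(x)\,dx$ and $\int e^{\int B(x)\,dx}f(x)R(x)\,dx$ exist on $I$. Then the general solution on $I$ of $$y''+B(x)y'+C(x)y=R(x)$$ is $$y=f(x)\int\frac{e^{-\int B(x)\,dx}}{f(x)^2}\left(\int e^{\int B(x)\,dx}f(x)R(x)\,dx\right)dx+C_1f(x)\int\frac{e^{-\int B(x)\,dx}}{f(x)^2}\,dx+C_2f(x),$$ where $C_1,C_2\in K$ are arbitrary constants; that is, a twice differentiable function $y:I\to K$ satisfies the differential equation on $I$ if and only if it has this form for some $C_1,C_2\in K$.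
   Context: An indefinite integral $\int u(x)\,dx$ of a function $u$ on $I$ denotes one fixed (arbitrarily chosen) antiderivative of $u$ on $I$, i.e. a differentiable function $U$ with $U'=u$ on $I$; each time the same integral occurs the same antiderivative is used. The arbitrary constants of integration are displayed explicitly as $C_1,C_2$. A complementary solution of the equation $y''+B(x)y'+C(x)y=R(x)$ is a solution of the corresponding homogeneous equation $y''+B(x)y'+C(x)y=0$. *)

(* Defs.v *)
(* Stdlib real numbers with Coquelicot. *)
From Stdlib Require Import Reals.
From Coquelicot Require Import Coquelicot.

Definition Cexp (z : C) : C :=
  (exp (fst z) * cos (snd z), exp (fst z) * sin (snd z))%R.

(* Coquelicot has no structure of normed field over R covering both R and C, so
   a code ranges over the two fields.  Addition, opposite and zero come from the
   normed real vector space [scalar K]. *)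
Inductive RorC : Set := RealField | ComplexField.

Definition scalar (K : RorC) : NormedModule R_AbsRing :=
  match K with
  | RealField => R_NormedModule
  | ComplexField => C_R_NormedModule
  end.

Definition smul {K : RorC} : scalar K -> scalar K -> scalar K :=
  match K with
  | RealField => Rmult
  | ComplexField => Cmult
  end.

Definition sinv {K : RorC} : scalar K -> scalar K :=
  match K with
  | RealField => Rinv
  | ComplexField => Cinv
  end.

Definition sexp {K : RorC} : scalar K -> scalar K :=
  match K with
  | RealField => exp
  | ComplexField => Cexp
  end.

Declare Scope scalar_scope.
Delimit Scope scalar_scope with K.
Notation "u + v" := (plus u v) : scalar_scope.
Notation "- u" := (opp u) : scalar_scope.
Notation "u * v" := (smul u v) : scalar_scope.
Notation "u / v" := (smul u (sinv v)) : scalar_scope.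

(* Endpoints may be infinite. Functions on the interval are represented by total
   functions on R, whose values outside the interval are irrelevant. *)
Definition in_open_itv (lo hi : Rbar) (x : R) : Prop :=
  Rbar_lt lo x /\ Rbar_lt x hi.

Definition antiderivative_on (lo hi : Rbar) {K : RorC}
    (u U : R -> scalar K) : Prop :=
  forall x, in_open_itv lo hi x -> is_derive U x (u x).

(* [y] is twice differentiable on the interval and y'' + B y' + C y = R there,
   where [b], [c], [r] are the coefficients B, C, R. *)
Definition is_solution_on (lo hi : Rbar) {K : RorC}
    (b c r y : R -> scalar K) : Prop :=
  exists y1 y2 : R -> scalar K,
    forall x, in_open_itv lo hi x ->
      is_derive y x (y1 x) /\
      is_derive y1 x (y2 x) /\
      (y2 x + b x * y1 x + c x * y x)%K = r x.

Definition is_complementary_solution_on (lo hi : Rbar) {K : RorC}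
    (b c y : R -> scalar K) : Prop :=
  is_solution_on lo hi b c (fun _ => zero) y.

(* Main.v *)
(* Let [P] be the antiderivative of [e^B f r], where [B] is that of [b].  If [y] is
   a solution, then [e^B (f y' - f' y) - P] has derivative zero, because [e^B] is
   an integrating factor for the Wronskian; so it is a constant [C1], and
   [(y / f)' = e^(-B) / f^2 (P + C1)].  Integrating once more gives [C2].
   Conversely, the formula is differentiated twice. *)
Require Import Defs.
From Stdlib Require Import Reals Lra Classical_Prop.
From Coquelicot Require Import Coquelicot.

(** * Field structure and differentiation rules common to both scalar fields *)

Definition sone {K : RorC} : scalar K :=
  match K with RealField => 1%R | ComplexField => RtoC 1 end.

(** Registered below for a variable [K], so that each algebraic identity is proved once for both
    fields. *)
Lemma scalar_field_theory (K : RorC) :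
  @field_theory (scalar K) zero sone plus smul minus opp
    (fun u v => smul u (sinv v)) sinv eq.
Proof.
destruct K.
- exact Rfield.
- exact C_field_theory.
Qed.

(** The projections and the pairing are linear, so complex differentiation reduces to the real rules
    in each component. *)
Lemma is_derive_C (g : R -> scalar ComplexField) (x : R) (l : scalar ComplexField) :
  is_derive g x l <->
  is_derive (fun t => fst (g t)) x (fst l) /\
  is_derive (fun t => snd (g t)) x (snd l).
Proof.
split.
- intros Hg; split.
  + apply (filterdiff_comp g fst (fun y => scal y l) fst Hg).
    apply filterdiff_linear, is_linear_fst.
  + apply (filterdiff_comp g snd (fun y => scal y l) snd Hg).
    apply filterdiff_linear, is_linear_snd.
- intros [H1 H2].
  apply (filterdiff_ext (fun t => (fst (g t), snd (g t)))).
  { intros t; symmetry; apply surjective_pairing. }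
  apply (filterdiff_ext_lin _
    (fun y : R => (scal y (fst l), scal y (snd l)) : C_R_NormedModule)).
  2: { intros t; reflexivity. }
  apply (filterdiff_comp'_2 (W := C_R_NormedModule)
    (fun t => fst (g t)) (fun t => snd (g t)) pair x _ _ pair H1 H2).
  apply (filterdiff_ext (fun t => t)).
  { intros t; apply surjective_pairing. }
  apply (filterdiff_ext_lin _ (fun t => t)).
  2: { intros t; apply surjective_pairing. }
  apply filterdiff_id.
Qed.

Lemma is_derive_smul {K : RorC} (g h : R -> scalar K) (x : R) (g' h' : scalar K) :
  is_derive g x g' -> is_derive h x h' ->
  is_derive (fun t => g t * h t)%K x (g' * h x + g x * h')%K.
Proof.
destruct K.
- intros Hg Hh; exact (is_derive_mult g h x g' h' Hg Hh Rmult_comm).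
- rewrite !is_derive_C.
  intros [Hg1 Hg2] [Hh1 Hh2]; split.
  + evar_last.
    * apply (is_derive_minus (V := R_NormedModule)).
      -- exact (is_derive_mult _ _ x _ _ Hg1 Hh1 Rmult_comm).
      -- exact (is_derive_mult _ _ x _ _ Hg2 Hh2 Rmult_comm).
    * simpl; unfold minus, plus, opp, mult; simpl; ring.
  + evar_last.
    * apply (is_derive_plus (V := R_NormedModule)).
      -- exact (is_derive_mult _ _ x _ _ Hg1 Hh2 Rmult_comm).
      -- exact (is_derive_mult _ _ x _ _ Hg2 Hh1 Rmult_comm).
    * simpl; unfold plus, mult; simpl; ring.
Qed.

Lemma is_derive_sexp {K : RorC} (g : R -> scalar K) (x : R) (g' : scalar K) :
  is_derive g x g' ->
  is_derive (fun t => sexp (g t)) x (g' * sexp (g x))%K.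
Proof.
destruct K.
- intros Hg. exact (is_derive_comp exp g x _ _ (is_derive_exp _) Hg).
- rewrite !is_derive_C.
  intros [Hg1 Hg2].
  pose proof (is_derive_comp exp _ x _ _ (is_derive_exp _) Hg1) as He.
  pose proof (is_derive_comp cos _ x _ _ (is_derive_cos _) Hg2) as Hc.
  pose proof (is_derive_comp sin _ x _ _ (is_derive_sin _) Hg2) as Hs.
  split; evar_last.
  + exact (is_derive_mult _ _ x _ _ He Hc Rmult_comm).
  + simpl; unfold scal, plus, mult; simpl; unfold mult; simpl; ring.
  + exact (is_derive_mult _ _ x _ _ He Hs Rmult_comm).
  + simpl; unfold scal, plus, mult; simpl; unfold mult; simpl; ring.
Qed.

Lemma sexp_opp {K : RorC} (u : scalar K) : (sexp u * sexp (- u))%K = sone.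
Proof.
destruct K.
- change (exp u * exp (- u) = 1)%R. now rewrite <- exp_plus, Rplus_opp_r, exp_0.
- destruct u as [a b].
  assert (Hab : (exp a * exp (- a) = 1)%R).
  { now rewrite <- exp_plus, Rplus_opp_r, exp_0. }
  pose proof (sin2_cos2 b) as Hsc; unfold Rsqr in Hsc.
  apply injective_projections; simpl; unfold opp; simpl; rewrite cos_neg, sin_neg.
  (* The real part is the real identity exp a exp (-a) = 1 times the Pythagorean identity. *)
  + transitivity ((exp a * exp (- a)) * (sin b * sin b + cos b * cos b))%R.
    * ring.
    * rewrite Hab, Hsc; ring.
  + ring.
Qed.

Lemma is_derive_Rinv (g : R -> R) (x g' : R) :
  g x <> 0%R -> is_derive g x g' ->
  is_derive (fun t => / g t)%R x (- (g' / (g x * g x)))%R.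
Proof.
intros Hx Hg. evar_last.
- exact (is_derive_inv g x g' Hg Hx).
- simpl; field; exact Hx.
Qed.

Lemma is_derive_sinv {K : RorC} (g : R -> scalar K) (x : R) (g' : scalar K) :
  g x <> zero -> is_derive g x g' ->
  is_derive (fun t => sinv (g t)) x (- (g' / (g x * g x)))%K.
Proof.
destruct K; intros Hx.
- apply is_derive_Rinv, Hx.
- rewrite !is_derive_C.
  intros [Hg1 Hg2].
  assert (Hn : (fst (g x) ^ 2 + snd (g x) ^ 2)%R <> 0%R).
  { intros H0. apply Hx.
    apply injective_projections; apply (Rplus_sqr_eq_0 (fst (g x)) (snd (g x)));
      rewrite !Rsqr_pow2; exact H0. }
  pose proof (is_derive_Rinv (fun t => fst (g t) ^ 2 + snd (g t) ^ 2)%R x _ Hn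
    (is_derive_plus _ _ x _ _ (is_derive_pow _ 2 x _ Hg1) (is_derive_pow _ 2 x _ Hg2))) as Hi.
  (* These are the denominators met by [field] below: the squared modulus of the square of p + iq,
     which is (p^2 + q^2)^2, and the squared modulus of p + iq itself. *)
  assert (Hsq : forall p q : R, (p ^ 2 + q ^ 2)%R <> 0%R ->
    ((p * p - q * q) * (p * p - q * q) + (p * q + q * p) * (p * q + q * p))%R <> 0%R /\
    (p * p + q * q)%R <> 0%R).
  { intros p q Hpq. split.
    - replace (_ + _)%R with ((p ^ 2 + q ^ 2) ^ 2)%R by ring. now apply pow_nonzero.
    - now replace (_ + _)%R with (p ^ 2 + q ^ 2)%R by ring. }
  apply Hsq in Hn; clear Hx Hsq.
  split; evar_last.
  + exact (is_derive_mult _ _ x _ _ Hg1 Hi Rmult_comm).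
  + simpl; destruct (g x) as [p q], g' as [p' q']; unfold plus, mult, opp; simpl.
    field; exact Hn.
  + exact (is_derive_mult _ _ x _ _ (is_derive_opp _ x _ Hg2) Hi Rmult_comm).
  + simpl; destruct (g x) as [p q], g' as [p' q']; unfold plus, mult, opp; simpl.
    field; exact Hn.
Qed.

(** * Constancy and antiderivatives on an open interval *)

Lemma in_open_itv_locally (lo hi : Rbar) (x : R) :
  in_open_itv lo hi x -> locally x (in_open_itv lo hi).
Proof.
intros [Hlo Hhi].
apply (locally_interval _ x lo hi Hlo Hhi).
intros y; split; assumption.
Qed.

Lemma in_open_itv_between (lo hi : Rbar) (x y z : R) :
  in_open_itv lo hi x -> in_open_itv lo hi y ->
  (Rmin x y <= z <= Rmax x y)%R -> in_open_itv lo hi z.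
Proof.
intros [Hx1 Hx2] [Hy1 Hy2] [Hz1 Hz2]; split.
- apply Rbar_lt_le_trans with (Rmin x y); [|exact Hz1].
  unfold Rmin; destruct (Rle_dec x y); assumption.
- apply Rbar_le_lt_trans with (Rmax x y); [exact Hz2|].
  unfold Rmax; destruct (Rle_dec x y); assumption.
Qed.

Lemma derive_zero_constant_on {V : NormedModule R_AbsRing} (lo hi : Rbar) (g : R -> V) :
  (forall x, in_open_itv lo hi x -> is_derive g x zero) ->
  exists k : V, forall x, in_open_itv lo hi x -> g x = k.
Proof.
intros Hg.
destruct (classic (exists x0, in_open_itv lo hi x0)) as [[x0 Hx0]|Hempty].
- exists (g x0); intros x Hx.
  destruct (Rtotal_order x x0) as [Hlt|[->|Hlt]]; [|reflexivity|symmetry].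
  + apply eq_is_derive; [|exact Hlt]. intros t Ht; apply Hg.
    apply (in_open_itv_between lo hi x x0); trivial.
    rewrite Rmin_left, Rmax_right; lra.
  + apply eq_is_derive; [|exact Hlt]. intros t Ht; apply Hg.
    apply (in_open_itv_between lo hi x0 x); trivial.
    rewrite Rmin_left, Rmax_right; lra.
(* On an empty interval any constant will do. *)
- exists zero; intros x Hx; elim Hempty; now exists x.
Qed.

Lemma real_antiderivative_exists (lo hi : Rbar) (u : R -> R) :
  (forall x, in_open_itv lo hi x -> continuous u x) ->
  exists U : R -> R, forall x, in_open_itv lo hi x -> is_derive U x (u x).
Proof.
intros Hu.
destruct (classic (exists x0, in_open_itv lo hi x0)) as [[x0 Hx0]|Hempty].
(* The integral from a base point of the interval; the segment from there to any other point stays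
   inside, where [u] is continuous. *)
- exists (RInt u x0); intros x Hx.
  apply (is_derive_RInt u _ x0); [|now apply Hu].
  apply (filter_imp (in_open_itv lo hi)); [|now apply in_open_itv_locally].
  intros y Hy; apply (RInt_correct u x0 y), ex_RInt_continuous.
  intros z Hz; apply Hu, (in_open_itv_between lo hi x0 y); assumption.
- exists u; intros x Hx; elim Hempty; now exists x.
Qed.

Lemma antiderivative_on_exists {K : RorC} (lo hi : Rbar) (u : R -> scalar K) :
  (forall x, in_open_itv lo hi x -> ex_derive u x) ->
  exists U, antiderivative_on lo hi u U.
Proof.
destruct K; intros Hu.
- apply real_antiderivative_exists.
  intros x Hx; now apply (ex_derive_continuous (V := R_NormedModule)), Hu.
- destruct (real_antiderivative_exists lo hi (fun t => fst (u t))) as [U1 HU1].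
  { intros x Hx; apply (ex_derive_continuous (V := R_NormedModule)).
    destruct (Hu x Hx) as [l [Hl _]%is_derive_C]; now exists (fst l). }
  destruct (real_antiderivative_exists lo hi (fun t => snd (u t))) as [U2 HU2].
  { intros x Hx; apply (ex_derive_continuous (V := R_NormedModule)).
    destruct (Hu x Hx) as [l [_ Hl]%is_derive_C]; now exists (snd l). }
  exists (fun t => (U1 t, U2 t)); intros x Hx.
  apply is_derive_C; split; [now apply HU1 | now apply HU2].
Qed.

(** * Reduction of order over a fixed scalar field *)

Section ReductionOfOrder.

Context (K : RorC).
Local Open Scope scalar_scope.

Add Field scalar_field : (scalar_field_theory K).

Lemma smul_sone_inj (u v : scalar K) : sone * u = sone * v -> u = v.
Proof. now rewrite !(Rmul_1_l (F_R (scalar_field_theory K))). Qed.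

(* [ring] and [field] look the structure up by the syntactic type of the
   left-hand side, which for a sum or an opposite is another projection of
   [scalar K] than the declared carrier; a leading [smul] has the right type. *)
Ltac scalar_ring :=
  match goal with |- @eq _ ?u ?v => apply (smul_sone_inj u v); ring end.
Ltac scalar_field :=
  match goal with |- @eq _ ?u ?v => apply (smul_sone_inj u v); field end.

Lemma smul_neq0 (u v : scalar K) : u <> zero -> v <> zero -> u * v <> zero.
Proof.
intros Hu Hv Huv; apply Hv.
transitivity (sinv u * (u * v)); [scalar_field; exact Hu | rewrite Huv; scalar_ring].
Qed.

Lemma sexp_neq0 (u : scalar K) : sexp u <> zero.
Proof.
intros Hu.
apply (F_1_neq_0 (scalar_field_theory K)).
rewrite <- (sexp_opp u), Hu; scalar_ring.
Qed.

(** Leaves a single exponential in the identities below, which makes them rational and accessible to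
    [field]. *)
Lemma sexp_oppE (u : scalar K) : sexp (- u) = sinv (sexp u).
Proof.
transitivity (sinv (sexp u) * (sexp u * sexp (- u))).
- scalar_field; apply sexp_neq0.
- rewrite sexp_opp; scalar_ring.
Qed.

Lemma is_derive_sdiv (g h : R -> scalar K) (x : R) (g' h' : scalar K) :
  h x <> zero -> is_derive g x g' -> is_derive h x h' ->
  is_derive (fun t => g t / h t) x ((g' * h x + - (g x * h')) / (h x * h x)).
Proof.
intros Hx Hg Hh.
evar_last; [exact (is_derive_smul _ _ x _ _ Hg (is_derive_sinv h x h' Hx Hh))|].
cbv beta; scalar_field; exact Hx.
Qed.

Lemma is_derive_sexp_opp (g : R -> scalar K) (x : R) (g' : scalar K) :
  is_derive g x g' ->
  is_derive (fun t => sexp (- g t)) x (- (g' * sexp (- g x))).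
Proof.
intros Hg.
evar_last; [exact (is_derive_sexp _ x _ (is_derive_opp g x g' Hg))|].
cbv beta; scalar_ring.
Qed.

Lemma is_derive_const_smul (k : scalar K) (g : R -> scalar K) (x : R) (g' : scalar K) :
  is_derive g x g' -> is_derive (fun t => k * g t) x (k * g').
Proof.
intros Hg.
evar_last; [exact (is_derive_smul _ _ x _ _ (is_derive_const k x) Hg)|].
cbv beta; scalar_ring.
Qed.

(** Differentiability of the weight e^(-B) / f^2 is what yields antiderivatives for both outer
    integrands of the formula. *)
Lemma is_derive_reduction_weight (f g : R -> scalar K) (x : R) (f' g' : scalar K) :
  f x <> zero -> is_derive f x f' -> is_derive g x g' ->
  ex_derive (fun t => sexp (- g t) / (f t * f t)) x.
Proof.
intros Hf0 Hf Hg; eexists.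
apply is_derive_sdiv; [now apply smul_neq0 | apply is_derive_sexp_opp; exact Hg |].
apply is_derive_smul; exact Hf.
Qed.

Lemma solution_reduction_form (lo hi : Rbar) (b c r f B P v w y : R -> scalar K) :
  is_complementary_solution_on lo hi b c f ->
  (forall x, in_open_itv lo hi x -> f x <> zero) ->
  antiderivative_on lo hi b B ->
  antiderivative_on lo hi (fun x => sexp (B x) * f x * r x) P ->
  antiderivative_on lo hi (fun x => sexp (- B x) / (f x * f x) * P x) v ->
  antiderivative_on lo hi (fun x => sexp (- B x) / (f x * f x)) w ->
  is_solution_on lo hi b c r y ->
  exists C1 C2 : scalar K, forall x, in_open_itv lo hi x ->
    y x = f x * v x + C1 * f x * w x + C2 * f x.
Proof.
intros [f1 [f2 Hf]] Hf0 HB HP Hv Hw [y1 [y2 Hy]].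
destruct (derive_zero_constant_on lo hi
  (fun t => sexp (B t) * (f t * y1 t + - (f1 t * y t)) + - P t)) as [C1 HC1].
{ intros x Hx.
  destruct (Hf x Hx) as [Df [Df1 Ef]], (Hy x Hx) as [Dy [Dy1 Ey]].
  evar_last.
  - apply (is_derive_plus (V := scalar K)); [|exact (is_derive_opp _ x _ (HP x Hx))].
    apply is_derive_smul; [exact (is_derive_sexp _ x _ (HB x Hx))|].
    exact (is_derive_plus _ _ x _ _ (is_derive_smul _ _ x _ _ Df Dy1)
      (is_derive_opp _ x _ (is_derive_smul _ _ x _ _ Df1 Dy))).
  - cbv beta; rewrite <- Ey.
    (* With [r] replaced by y'' + b y' + c y, the terms in y' and y'' cancel; what remains is a
       multiple of the homogeneous equation for [f]. *)
    transitivity (- (sexp (B x) * y x * (f2 x + b x * f1 x + c x * f x))); [scalar_ring|].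
    rewrite Ef; scalar_ring. }
destruct (derive_zero_constant_on lo hi
  (fun t => y t / f t + - (v t + C1 * w t))) as [C2 HC2].
{ intros x Hx.
  destruct (Hf x Hx) as [Df [Df1 _]], (Hy x Hx) as [Dy [Dy1 _]].
  evar_last.
  - apply (is_derive_plus (V := scalar K)).
    + exact (is_derive_sdiv _ _ x _ _ (Hf0 x Hx) Dy Df).
    + exact (is_derive_opp _ x _ (is_derive_plus _ _ x _ _ (Hv x Hx)
        (is_derive_const_smul C1 _ x _ (Hw x Hx)))).
  (* Replacing [C1] by its expression at [x] turns P + C1 into e^B times the Wronskian, and the
     derivative of y / f is the Wronskian over f^2. *)
  - cbv beta; rewrite <- (HC1 x Hx), sexp_oppE.
    scalar_field; split; [exact (Hf0 x Hx) | apply sexp_neq0]. }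
exists C1, C2; intros x Hx.
rewrite <- (HC2 x Hx); scalar_field; exact (Hf0 x Hx).
Qed.

Lemma reduction_form_solution (lo hi : Rbar) (b c r f B P v w y : R -> scalar K)
    (C1 C2 : scalar K) :
  is_complementary_solution_on lo hi b c f ->
  (forall x, in_open_itv lo hi x -> f x <> zero) ->
  antiderivative_on lo hi b B ->
  antiderivative_on lo hi (fun x => sexp (B x) * f x * r x) P ->
  antiderivative_on lo hi (fun x => sexp (- B x) / (f x * f x) * P x) v ->
  antiderivative_on lo hi (fun x => sexp (- B x) / (f x * f x)) w ->
  (forall x, in_open_itv lo hi x ->
    y x = f x * v x + C1 * f x * w x + C2 * f x) ->
  is_solution_on lo hi b c r y.
Proof.
intros [f1 [f2 Hf]] Hf0 HB HP Hv Hw Hy.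
(* Here [g] is the quotient y / f, [h] is chosen so that g' = (h / f) (P + C1), and [h1] is the
   derivative of [h]. Hence y' = f' g + h (P + C1), and the product rule gives the second
   witness. *)
pose (g := fun t => v t + C1 * w t + C2).
pose (h := fun t => sexp (- B t) / f t).
pose (h1 := fun t => - (h t * (b t + f1 t / f t))).
exists (fun t => f1 t * g t + h t * (P t + C1)).
exists (fun t => f2 t * g t + f1 t * (h t / f t * (P t + C1))
  + (h1 t * (P t + C1) + h t * (sexp (B t) * f t * r t))).
intros x Hx.
destruct (Hf x Hx) as [Df [Df1 Ef]].
pose proof (Hf0 x Hx) as Hfx.
assert (Dg : is_derive g x (h x / f x * (P x + C1))).
{ evar_last.
  - apply (is_derive_plus (V := scalar K)); [|exact (is_derive_const C2 x)].
    exact (is_derive_plus _ _ x _ _ (Hv x Hx) (is_derive_const_smul C1 _ x _ (Hw x Hx))).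
  - unfold h; cbv beta; scalar_field; exact Hfx. }
assert (Dh : is_derive h x (h1 x)).
{ evar_last.
  - exact (is_derive_sdiv _ _ x _ _ Hfx (is_derive_sexp_opp _ x _ (HB x Hx)) Df).
  - unfold h1, h; cbv beta; scalar_field; exact Hfx. }
split; [|split].
(* The formula for [y] is known only on the interval, so the derivative is transferred through
   equality near [x]. *)
- apply (is_derive_ext_loc (fun t => f t * g t)).
  { apply (filter_imp (in_open_itv lo hi)); [|now apply in_open_itv_locally].
    intros t Ht; rewrite (Hy t Ht); unfold g; scalar_ring. }
  evar_last; [exact (is_derive_smul _ _ x _ _ Df Dg)|].
  cbv beta; scalar_field; exact Hfx.
- evar_last.
  + apply (is_derive_plus (V := scalar K)); [exact (is_derive_smul _ _ x _ _ Df1 Dg)|].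
    eapply (is_derive_smul h (fun t => P t + C1) x _ _ Dh).
    exact (is_derive_plus _ _ x _ _ (HP x Hx) (is_derive_const C1 x)).
  + cbv beta; scalar_ring.
- rewrite (Hy x Hx); unfold h1, h, g; rewrite sexp_oppE.
  (* The coefficient of P + C1 is h f' / f + h' + b h = 0, and h e^B f = 1 leaves exactly [r]; the
     factor of [g] is the homogeneous equation for [f]. *)
  transitivity ((f2 x + b x * f1 x + c x * f x) * (v x + C1 * w x + C2) + r x).
  + scalar_field; split; [exact Hfx | apply sexp_neq0].
  + rewrite Ef; scalar_ring.
Qed.

End ReductionOfOrder.

Theorem corollary4 (K : RorC) (lo hi : Rbar) (b c r f : R -> scalar K)
    (f_compl : is_complementary_solution_on lo hi b c f)
    (f_neq0 : forall x : R, in_open_itv lo hi x -> f x <> zero)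
    (intb : R -> scalar K)
    (intb_prim : antiderivative_on lo hi b intb)
    (intfr : R -> scalar K)
    (intfr_prim : antiderivative_on lo hi
       (fun x => sexp (intb x) * f x * r x)%K intfr) :
  (exists v : R -> scalar K, antiderivative_on lo hi
     (fun x => sexp (- intb x) / (f x * f x) * intfr x)%K v) /\
  (exists w : R -> scalar K, antiderivative_on lo hi
     (fun x => sexp (- intb x) / (f x * f x))%K w) /\
  (forall v w : R -> scalar K,
     antiderivative_on lo hi
       (fun x => sexp (- intb x) / (f x * f x) * intfr x)%K v ->
     antiderivative_on lo hi
       (fun x => sexp (- intb x) / (f x * f x))%K w ->
     forall y : R -> scalar K,
       is_solution_on lo hi b c r y <->
       exists C1 C2 : scalar K,
         forall x : R, in_open_itv lo hi x ->
           y x = (f x * v x + C1 * f x * w x + C2 * f x)%K).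
Proof.
assert (Dq : forall x, in_open_itv lo hi x ->
  ex_derive (fun t => sexp (- intb t) / (f t * f t))%K x).
{ intros x Hx; destruct f_compl as [f1 [f2 Hf]], (Hf x Hx) as [Df _].
  exact (is_derive_reduction_weight K f intb x _ _ (f_neq0 x Hx) Df (intb_prim x Hx)). }
split; [|split].
(* As an antiderivative, [intfr] is differentiable even where [r] is not continuous, so its product
   with the weight is differentiable. *)
- apply antiderivative_on_exists; intros x Hx; destruct (Dq x Hx) as [q' Hq].
  eexists; exact (is_derive_smul _ _ x _ _ Hq (intfr_prim x Hx)).
- apply antiderivative_on_exists; exact Dq.
- intros v w Hv Hw y; split.
  + now apply (solution_reduction_form K lo hi b c r f intb intfr).
  + intros [C1 [C2 Hy]].
    now apply (reduction_form_solution K lo hi b c r f intb intfr v w y C1 C2).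
Qed.
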